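(* Let $\{M(t)\}_{t\ge0}$ be the generalized counting process with rates $\lambda_1,\dots,\lambda_k>0$, $\Lambda=\lambda_1+\cdots+\lambda_k$, and let $\{D_f(t)\}_{t\ge0}$ be an independent Lévy subordinator with Bernstein function $f$. The state probabilities $p_{f}(n,t)=\Pr\{M_{f}(t)=n\}$, $n\ge0$, of the process $M_f(t)=M(D_f(t))$ solve the system of differential equations $$\frac{\mathrm{d}}{\mathrm{d}t}p_{f}(n,t)=-f(\Lambda)p_{f}(n,t)-\sum_{m=1}^{n}\sum_{ \Omega(k,m)}f^{(z_{k})}(\Lambda)\left(\prod_{j=1}^{k}\frac{(-\lambda_{j})^{x_{j}}}{x_{j}!}\right)p_{f}(n-m,t),$$ with initial conditions $p_f(0,0)=1$ and $p_f(n,0)=0$ for $n\ge1$, where $z_k=x_1+\cdots+x_k$.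
   Context: Generalized counting process (GCP): the Lévy process $\{M(t)\}_{t\ge0}$ with values in the non-negative integers, $M(0)=0$, and $\Pr\{M(t)=n\}=\sum_{\Omega(k,n)}\prod_{j=1}^{k}\frac{(\lambda_{j}t)^{x_{j}}}{x_{j}!}e^{-\Lambda t}$, where $\Omega(k,n)=\{(x_1,\dots,x_k): x_j\in\{0,1,2,\dots\},\ \sum_{j=1}^k jx_j=n\}$. Lévy subordinator: a (finite-valued) non-decreasing Lévy process with $\mathbb{E}(e^{-sD_f(t)})=e^{-tf(s)}$, where $f(s)=c_2s+\int_0^\infty(1-e^{-sx})\,\overline\nu(\mathrm{d}x)$, $c_2\ge0$, $\int_0^\infty(x\wedge1)\,\overline\nu(\mathrm{d}x)<\infty$, so that $f(0)=0$. $f^{(r)}$ denotes the $r$-th derivative of $f$. The process $M_f$ is called the time-changed generalized counting process-I (TCGCP-I). *)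

(* Defs.v *)
From HB Require Import structures.
From mathcomp Require Import all_boot all_order all_algebra.
From mathcomp Require Import all_classical all_reals all_analysis.

Set Implicit Arguments.
Unset Strict Implicit.
Unset Printing Implicit Defensive.

Import Order.TTheory GRing.Theory Num.Theory.
Import numFieldNormedType.Exports.

Local Open Scope classical_set_scope.
Local Open Scope ring_scope.

(* A process is a function X : R -> T -> U. Its time set is [0, +oo[: only the
   values X t with 0 <= t are ever constrained. *)

Section Independence.
Context {d : measure_display} {T : measurableType d} {R : realType}.
Variable P : probability T R.

(* The sets B i may be the whole space, so the product rule over all of I
   contains the product rule over every subfamily. *)
Definition mutually_independent {I : finType} {d' : measure_display}
    {U : measurableType d'} (Y : I -> T -> U) : Prop :=
  forall B : I -> set U, (forall i, measurable (B i)) ->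
    P [set w | forall i, B i (Y i w)] =
    (\prod_(i : I) fine (P (Y i @^-1` B i)))%:E.

Definition sigma_of_process {d' : measure_display} {U : measurableType d'}
    (X : R -> T -> U) : set (set T) :=
  <<s [set E | exists t B, [/\ 0 <= t, measurable B & E = X t @^-1` B] ]>>.

Definition independent_processes {d1 d2 : measure_display}
    {U1 : measurableType d1} {U2 : measurableType d2}
    (X : R -> T -> U1) (Y : R -> T -> U2) : Prop :=
  forall E F, sigma_of_process X E -> sigma_of_process Y F ->
    P (E `&` F) = (P E * P F)%E.

End Independence.

Section Levy.
Context {d : measure_display} {T : measurableType d} {R : realType}.
Variable P : probability T R.

(* All paths, and not only almost all, are cadlag. Stochastic continuity
   follows from right-continuity and stationarity. *)
Record levy_process (X : R -> T -> R) : Prop := LevyProcess {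
  levy_measurable : forall t, 0 <= t -> measurable_fun setT (X t) ;
  levy_start : {ae P, forall w, X 0 w = 0} ;
  levy_independent_increments : forall (n : nat) (t : nat -> R),
    0 <= t 0%N -> (forall i, (i < n)%N -> t i <= t i.+1) ->
    mutually_independent P (fun (i : 'I_n) w => X (t i.+1) w - X (t i) w) ;
  levy_stationary_increments : forall s t, 0 <= s -> 0 <= t ->
    forall B : set R, measurable B ->
      P [set w | B (X (s + t) w - X s w)] = P [set w | B (X t w)] ;
  levy_right_continuous : forall w t, 0 <= t ->
    X s w @[s --> t^'+] --> X t w ;
  levy_left_limits : forall w t, 0 < t -> cvg (X s w @[s --> t^'-]) }.

(* f on [0, +oo[ is given by drift c2 and Levy measure nu; nu lives on
   ]0, +oo[, so its values outside that interval are never used. *)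
Definition bernstein_function (f : R -> R) : Prop :=
  exists (c2 : R) (nu : {measure set (measurableTypeR R) -> \bar R}),
    [/\ 0 <= c2,
        (\int[nu]_(x in `]0%R, +oo[) (Num.min x 1)%:E < +oo)%E &
        forall s, 0 <= s ->
          f s = c2 * s + \int[nu]_(x in `]0%R, +oo[) (1 - expR (- (s * x)))].

(* Nonnegativity is required for every w because D is used as a time. *)
Record levy_subordinator (f : R -> R) (D : R -> T -> R) : Prop :=
  LevySubordinator {
  subordinator_levy : levy_process D ;
  subordinator_ge0 : forall t w, 0 <= t -> 0 <= D t w ;
  subordinator_nondecreasing :
    {ae P, forall w, forall s t, 0 <= s -> s <= t -> D s w <= D t w} ;
  subordinator_bernstein : bernstein_function f ;
  subordinator_laplace : forall s t, 0 <= s -> 0 <= t ->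
    ('E_P[fun w => expR (- (s * D t w))] = (expR (- (t * f s)))%:E)%E }.

End Levy.

(* The index j : 'I_k stands for j.+1 in {1, ..., k}. *)
Definition Omega (k n : nat) : set {ffun 'I_k -> nat} :=
  [set x | (\sum_(j < k) j.+1 * x j)%N = n].
Arguments Omega : clear implicits.

(* In particular \sum_(x \in Omega k n) is never the default value 0 of a sum
   with infinite support. *)
Lemma finite_Omega (k n : nat) : finite_set (Omega k n).
Proof.
pose g (y : {ffun 'I_k -> 'I_n.+1}) : {ffun 'I_k -> nat} :=
  [ffun j => nat_of_ord (y j)].
apply: (sub_finite_set (B := g @` setT)); last first.
  by apply: finite_image; exact: finite_finset.
move=> x xn; exists [ffun j => inord (x j)] => //.
apply/ffunP => j; rewrite !ffunE inordK// ltnS -xn (bigD1 j)//=.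
by rewrite (leq_trans _ (leq_addr _ _))// leq_pmull.
Qed.

Section GCP.
Context {d : measure_display} {T : measurableType d} {R : realType}.
Variable P : probability T R.

Definition total_rate {k : nat} (lam : 'I_k -> R) : R := \sum_(j < k) lam j.

Record generalized_counting_process {k : nat} (lam : 'I_k -> R)
    (M : R -> T -> nat) : Prop := GeneralizedCountingProcess {
  gcp_levy : levy_process P (fun t w => (M t w)%:R) ;
  gcp_distribution : forall (n : nat) t, 0 <= t ->
    P [set w | M t w = n] =
    (\sum_(x \in Omega k n)
      (\prod_(j < k) ((lam j * t) ^+ x j / (x j)`!%:R)) *
      expR (- (total_rate lam * t)))%:E }.

Definition time_change {U : Type} (M : R -> T -> U) (D : R -> T -> R) :
  R -> T -> U := fun t w => M (D t w) w.

Definition state_prob (X : R -> T -> nat) (n : nat) (t : R) : R :=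
  fine (P [set w | X t w = n]).

End GCP.

(* Main.v *)
Require Import Defs.
From HB Require Import structures.
From mathcomp Require Import all_boot all_order all_algebra.
From mathcomp Require Import all_classical all_reals all_analysis.
From mathcomp Require Import measurable_realfun.
From mathcomp Require Import ring zify.

Set Implicit Arguments.
Unset Strict Implicit.
Unset Printing Implicit Defensive.

Import Order.TTheory GRing.Theory Num.Theory.
Import numFieldNormedType.Exports.

Local Open Scope classical_set_scope.
Local Open Scope ring_scope.

(** Why the system holds. Conditioning on the independent clock [D t] gives
    [p n t = E (q_n (D t))], where [q_n u] is the probability that the counting
    process is at [n] at time [u]. That law is a finite combination of the
    functions [(- u) ^ z * exp (- Lam * u)], whose expectations at [u = D t] are
    the derivatives at [Lam] of the Laplace transform [exp (- t * f s)] of [D t].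
    So [p n t = A_n (exp (- t * f))] with the linear functional
    [A_n h = \sum_(x in Omega k n) h^(z_k)(Lam) * prod_j (- lam_j)^x_j / x_j!]
    ([state_prob_time_change]).

    By Taylor's formula and the multinomial theorem, [A_n h] is the coefficient
    of [X ^ n] in the formal composite
    [h (Lam - (lam_1 X + ... + lam_k X ^ k))]. Products of functions therefore
    become Cauchy products: [A_n (g * h) = \sum_(m <= n) A_m g * A_(n - m) h]
    ([omega_sumM]). Since differentiation in [t] replaces [exp (- t * f)] by
    [- f * exp (- t * f)], it follows that
    [dp_n/dt = - \sum_(m <= n) A_m f * p_(n - m)]; the term [m = 0] is
    [- f Lam * p_n], and the others form the double sum of the system.

    Three analytic points support this computation. The identity
    [P (M (D t) = n) = E (q_n (D t))] is clear for a clock with countably many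
    values; the general case follows by approximating [D t] strictly from above
    and using that the paths of [M] are right-continuous
    ([prob_random_time]). The Laplace transform of [D t] is differentiated
    under the expectation ([jet_laplace_moment]). The function [f] is smooth on
    the open half-line because there it equals minus the logarithm of the
    Laplace transform of [D 1] ([jet_bernstein]), and the derivative in [t]
    commutes with the derivatives in [s] by induction on the order
    ([is_derive_exp_jet]). The resulting formula for [p n t] makes sense and is
    differentiable for all real [t], which also yields the one-sided derivative
    at [0]. *)

(** * Sums over [Omega] as coefficients of a formal composite *)

(** The product of exponential generating functions, as an operation on the
    sequences of their coefficients. *)
Definition binconv (R : pzRingType) (a b : nat -> R) (n : nat) : R :=
  \sum_(i < n.+1) 'C(n, i)%:R * a i * b (n - i)%N.

(** Substituting a polynomial without constant term is compatible with
    truncation: [g ^+ i] starts in degree [i] at least. *)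
Lemma coef_comp_poly_trunc (R : comNzRingType) (p g : {poly R}) (n N : nat) :
  g`_0 = 0 -> (n < N)%N -> (p \Po g)`_n = \sum_(i < N) p`_i * (g ^+ i)`_n.
Proof.
move=> g0 nN.
have gi i : (n < i)%N -> (g ^+ i)`_n = 0.
  move=> ni; have -> : g = drop_poly 1 g * 'X.
    have := poly_take_drop 1 g; rewrite expr1 => {1}<-.
    rewrite -[RHS]add0r; congr (_ + _).
    by apply/polyP => -[|j]; rewrite coef_take_poly coef0.
  by rewrite exprMn coefMXn ni.
rewrite comp_polyE coef_sum; under eq_bigr do rewrite coefZ.
pose F i := p`_i * (g ^+ i)`_n.
rewrite -!(big_mkord xpredT F).
pose Q := maxn (size p) N.
have widen (m : nat) : (m <= Q)%N -> (forall i, (m <= i)%N -> F i = 0) ->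
    \sum_(0 <= i < m) F i = \sum_(0 <= i < Q) F i.
  move=> mQ F0; rewrite (big_cat_nat _ mQ)//= [X in _ + X]big1_seq ?addr0//.
  by move=> i /andP[_]; rewrite mem_index_iota => /andP[mi _]; exact: F0.
rewrite widen ?leq_maxl// => [|i pi]; last by rewrite /F nth_default// mul0r.
rewrite widen ?leq_maxr// => i Ni.
by rewrite /F gi ?mulr0// (leq_trans nN).
Qed.

(** The multinomial theorem in divided powers. Both sides are the coefficient of
    degree [z] in the product of the truncated exponential series of the [a j]:
    on the left because such series multiply by the binomial formula, on the
    right by expanding the product. *)
Lemma multinomial_divided_powers (F : numFieldType) (A : comAlgType F)
    (k : nat) (a : 'I_k -> A) (N z : nat) : (z <= N)%N ->
  (z`!%:R : F)^-1 *: (\sum_(j < k) a j) ^+ z =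
  \sum_(y : {ffun 'I_k -> 'I_N.+1} | (\sum_(j < k) y j)%N == z)
     \prod_(j < k) (((y j)`!%:R : F)^-1 *: a j ^+ y j).
Proof.
move=> zN.
(* [E x p] says that [p] agrees with the exponential of [x * 'X] up to degree [N]. *)
pose E (x : A) (p : {poly A}) := forall i, (i <= N)%N ->
  p`_i = ((i`!%:R : F)^-1 *: x ^+ i).
pose P j : {poly A} := \poly_(i < N.+1) ((i`!%:R : F)^-1 *: a j ^+ i).
have EP : E (\sum_(j < k) a j) (\prod_(j < k) P j).
  apply: (big_ind2 E).
  - move=> [|i] _; rewrite coef1/=.
      by rewrite fact0 invr1 expr0 scale1r.
    by rewrite expr0n/= scaler0.
  - move=> x p y q Ex Ey i iN; rewrite coefM exprDn scaler_sumr.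
    rewrite [RHS](reindex_inj rev_ord_inj)/=.
    apply: eq_bigr => j _; rewrite subSS.
    have ji : (j <= i)%N by rewrite -ltnS.
    rewrite subKn// Ex ?(leq_trans ji)// Ey ?(leq_trans (leq_subr _ _))//.
    rewrite -scalerAl -scalerAr scalerA bin_sub//.
    rewrite -[X in _ = _ *: X](@scaler_nat F) [RHS]scalerA; congr (_ *: _).
    have := @bin_fact i j ji => /(congr1 (fun n => n%:R : F)).
    rewrite !natrM => <-.
    have f0 m : (m`!%:R : F) != 0 by rewrite pnatr_eq0 -lt0n fact_gt0.
    have c0 : ('C(i, j)%:R : F) != 0 by rewrite pnatr_eq0 -lt0n bin_gt0.
    by rewrite invfM mulrAC mulVf// mul1r invfM.
  - by move=> j _ i iN; rewrite coef_poly ltnS iN.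
rewrite -EP// /P; under eq_bigr do rewrite poly_def.
rewrite bigA_distr_bigA coef_sum [RHS]big_mkcond/=.
apply: eq_bigr => y _.
under eq_bigr do rewrite -mul_polyC.
rewrite big_split/= -rmorph_prod/= -(big_morph _ (@exprD _ 'X) (expr0 _))/=.
rewrite coefCM coefXn eq_sym.
by case: ifP; rewrite (mulr1, mulr0).
Qed.

Section OmegaSum.
Context {R : realType} {k : nat}.
Implicit Types (mu : 'I_k -> R) (a b : nat -> R).

(** If [a z] is the [z]-th derivative of a function [h] at a point [s], this is
    the coefficient of ['X^n] in the formal Taylor expansion of
    [h (s + \sum_j mu j * 'X^(j.+1))]; see [omega_sum_coef]. *)
Definition omega_sum mu (n : nat) a : R :=
  \sum_(x \in Omega k n)
    a (\sum_(j < k) x j)%N * \prod_(j < k) (mu j ^+ x j / (x j)`!%:R).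

Definition jump_poly mu : {poly R} := \sum_(j < k) mu j *: 'X^(j.+1).

Lemma jump_poly_coef0 mu : (jump_poly mu)`_0 = 0.
Proof.
by rewrite coef_sum big1// => j _; rewrite coefZ coefXn mulr0.
Qed.

(** Every coordinate of a point of [Omega k n] is at most [n], so that the sum
    ranges over a finite type. *)
Lemma omega_sum_ffun mu n a : omega_sum mu n a =
  \sum_(y : {ffun 'I_k -> 'I_n.+1} | (\sum_(j < k) j.+1 * y j)%N == n)
    a (\sum_(j < k) y j)%N * \prod_(j < k) (mu j ^+ y j / (y j)`!%:R).
Proof.
pose h (y : {ffun 'I_k -> 'I_n.+1}) : {ffun 'I_k -> nat} :=
  [ffun j => nat_of_ord (y j)].
pose P (y : {ffun 'I_k -> 'I_n.+1}) := (\sum_(j < k) j.+1 * y j)%N == n.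
have hsum (c : 'I_k -> nat) y :
    (\sum_(j < k) c j * h y j = \sum_(j < k) c j * y j)%N.
  by apply: eq_bigr => j _; rewrite ffunE.
rewrite /omega_sum (reindex_fsbig h [set` P]); last first.
  split.
  - by move=> y /= /eqP yn; rewrite /Omega/= hsum.
  - move=> y z _ _ /ffunP yz; apply/ffunP => j; apply/val_inj.
    by have := yz j; rewrite !ffunE.
  - move=> x xn; have xE j : (inord (x j) : 'I_n.+1) = x j :> nat.
      rewrite inordK// ltnS -xn (bigD1 j)//=.
      by rewrite (leq_trans _ (leq_addr _ _))// leq_pmull.
    exists [ffun j => inord (x j)]; last first.
      by apply/ffunP => j; rewrite !ffunE xE.
    apply/eqP; transitivity (\sum_(j < k) j.+1 * x j)%N; last exact: xn.
    by apply: eq_bigr => j _; rewrite ffunE xE.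
rewrite -(@bigfs _ _ _ _ (index_enum _) P) ?index_enum_uniq//; last first.
  by move=> y _; rewrite mem_index_enum.
apply: eq_bigr => y _; congr (a _ * _).
  by apply: eq_bigr => j _; rewrite ffunE.
by apply: eq_bigr => j _; rewrite ffunE.
Qed.

Lemma coef_jump_poly_exp mu n z : (z <= n)%N ->
  (jump_poly mu ^+ z)`_n / z`!%:R =
  \sum_(y : {ffun 'I_k -> 'I_n.+1} |
      ((\sum_(j < k) j.+1 * y j)%N == n) && ((\sum_(j < k) y j)%N == z))
    \prod_(j < k) (mu j ^+ y j / (y j)`!%:R).
Proof.
move=> zn; rewrite mulrC -coefZ (multinomial_divided_powers _ zn) coef_sum.
rewrite [RHS]big_mkcondl/=; apply: eq_bigr => y _.
under eq_bigr do rewrite exprZn scalerA mulrC -exprM -mul_polyC.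
rewrite big_split/= -rmorph_prod/= -(big_morph _ (@exprD _ 'X) (expr0 _))/=.
by rewrite coefCM coefXn eq_sym; case: ifP; rewrite (mulr1, mulr0).
Qed.

(** Group the multi-indices [x] by their size [z = \sum_j x j], on which alone [a]
    depends; the multinomial theorem sums each group. *)
Lemma omega_sum_coef mu n a : omega_sum mu n a =
  \sum_(z < n.+1) a z / z`!%:R * (jump_poly mu ^+ z)`_n.
Proof.
rewrite omega_sum_ffun.
have cardle (y : {ffun 'I_k -> 'I_n.+1}) :
    (\sum_(j < k) j.+1 * y j)%N == n -> (\sum_(j < k) y j <= n)%N.
  by move=> /eqP yn; rewrite -[leqRHS]yn; apply: leq_sum => j _; rewrite leq_pmull.
rewrite (partition_big (fun y : {ffun 'I_k -> 'I_n.+1} =>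
  inord (\sum_(j < k) y j)%N : 'I_n.+1) xpredT)//=.
apply: eq_bigr => z _.
rewrite mulrAC -mulrA coef_jump_poly_exp; last by rewrite -ltnS.
rewrite mulr_sumr.
apply: eq_big => [y|y /andP[yn /eqP <-]]; last by rewrite inordK ?ltnS ?cardle.
case: eqP => //= /eqP /cardle yn; apply/eqP/eqP => [<-|yz].
  by rewrite inordK.
by apply/val_inj; rewrite /= inordK.
Qed.

(** A binomial convolution is the sequence of derivatives of a product of two
    functions, and the expansion of a product is the product of the expansions. *)
Lemma omega_sumM mu n a b : omega_sum mu n (binconv a b) =
  \sum_(m < n.+1) omega_sum mu m a * omega_sum mu (n - m) b.
Proof.
(* [hat c] is the Taylor polynomial of a function with derivatives [c]. *)
pose hat c : {poly R} := \poly_(i < n.+1) (c i / i`!%:R).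
have omega_hat c m : (m <= n)%N ->
    omega_sum mu m c = (hat c \Po jump_poly mu)`_m.
  move=> mn; rewrite (coef_comp_poly_trunc _ (jump_poly_coef0 mu) (ltnSn m)).
  rewrite omega_sum_coef; apply: eq_bigr => z _.
  by rewrite coef_poly (leq_trans (ltn_ord z)).
transitivity (((hat a * hat b) \Po jump_poly mu)`_n); last first.
  rewrite comp_polyM coefM; apply: eq_bigr => m _.
  by rewrite omega_hat ?omega_hat ?leq_subr//; rewrite -ltnS.
rewrite (coef_comp_poly_trunc _ (jump_poly_coef0 mu) (ltnSn n)).
rewrite omega_sum_coef; apply: eq_bigr => z _; congr (_ * _).
rewrite coefM mulr_suml; apply: eq_bigr => i _.
have iz : (i <= z)%N by rewrite -ltnS.
have zn : (z < n.+1)%N by [].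
rewrite !coef_poly (leq_ltn_trans iz)// (leq_ltn_trans (leq_subr _ _))//.
have := @bin_fact z i iz => /(congr1 (fun n => n%:R : R)); rewrite !natrM => <-.
have f0 m : (m`!%:R : R) != 0 by rewrite pnatr_eq0 -lt0n fact_gt0.
have c0 : ('C(z, i)%:R : R) != 0 by rewrite pnatr_eq0 -lt0n bin_gt0.
by field; rewrite c0 !f0.
Qed.

End OmegaSum.

(** * Smooth functions on the open half-line *)

Section Jets.
Context {R : realType}.
Implicit Types (f g : R -> R) (F G : nat -> R -> R) (s t : R).

Lemma is_derive_mulr f g s (df dg : R) :
  is_derive s 1 f df -> is_derive s 1 g dg ->
  is_derive s (1 : R) (fun x => f x * g x) (df * g s + f s * dg).
Proof.
move=> Df Dg; have := is_deriveM Df Dg.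
by move=> /is_derive_eq; apply; rewrite addrC mulrC.
Qed.

Lemma is_derive_cmulr f s (c df : R) :
  is_derive s 1 f df -> is_derive s (1 : R) (fun x => c * f x) (c * df).
Proof. by move=> Df; exact: (is_deriveZ c Df). Qed.

Lemma is_derive_bigsum (n : nat) (h : 'I_n -> R -> R) (dh : 'I_n -> R) s :
  (forall i, is_derive s (1 : R) (h i) (dh i)) ->
  is_derive s (1 : R) (fun x => \sum_(i < n) h i x) (\sum_(i < n) dh i).
Proof.
move=> /is_derive_sum; congr (is_derive _ _ _ _).
by apply/funext => x; rewrite fct_sumE.
Qed.

Lemma near_pos (P : R -> Prop) s : 0 < s -> (forall x, 0 < x -> P x) ->
  \forall x \near s, P x.
Proof.
move=> s0 Pp; have := lt_nbhsr s0; apply: filterS => x.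
exact: Pp.
Qed.

(** A jet is a function on the open half-line together with all its successive
    derivatives. Working with the whole sequence replaces statements about
    iterated derivatives by order-by-order ones. *)
Definition jet F := forall i s, 0 < s -> is_derive s (1 : R) (F i) (F i.+1 s).

Lemma jet_eq F G : jet F -> jet G -> (forall s, 0 < s -> F 0%N s = G 0%N s) ->
  forall i s, 0 < s -> F i s = G i s.
Proof.
move=> jF jG FG0; elim=> [//|i IH] s s0.
have [_ <-] := jF i s s0; have [_ <-] := jG i s s0.
by apply: near_eq_derive; exact: near_pos.
Qed.

Lemma jetS F : jet F -> jet (fun i => F i.+1).
Proof. by move=> jF i; exact: jF. Qed.

Lemma jetD F G : jet F -> jet G -> jet (fun i s => F i s + G i s).
Proof. by move=> jF jG i s s0; apply: is_deriveD; [exact: jF|exact: jG]. Qed.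

Lemma jetZ (c : R) F : jet F -> jet (fun i s => c * F i s).
Proof. by move=> jF i s s0; apply: is_derive_cmulr; exact: jF. Qed.

Definition leibniz F G (n : nat) s : R := binconv (F ^~ s) (G ^~ s) n.

Lemma leibniz0 F G s : leibniz F G 0 s = F 0%N s * G 0%N s.
Proof. by rewrite /leibniz /binconv big_ord1 bin0 mul1r. Qed.

Lemma leibniz1 F G s :
  leibniz F G 1 s = F 0%N s * G 1%N s + F 1%N s * G 0%N s.
Proof.
by rewrite /leibniz /binconv big_ord_recr big_ord1 subn0 subnn bin0 bin1 !mul1r.
Qed.

(** Leibniz' rule: Pascal's triangle is exactly what makes the binomial
    convolution of two jets closed under differentiation. *)
Lemma jetM F G : jet F -> jet G -> jet (leibniz F G).
Proof.
move=> jF jG n s s0; rewrite /leibniz /binconv.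
apply: is_derive_eq.
  apply: is_derive_bigsum => i; apply: is_derive_mulr; last exact: jG.
  by apply: is_derive_cmulr; exact: jF.
rewrite big_split/=.
rewrite [RHS]big_ord_recl/= bin0 subn0.
under [in RHS]eq_bigr => i _ do rewrite /bump/= add1n subSS binS natrD 2!mulrDl.
rewrite big_split/= [RHS]addrA [LHS]addrC; congr (_ + _).
rewrite [LHS]big_ord_recl/= bin0 subn0; congr (_ + _).
rewrite [RHS]big_ord_recr/= bin_small// !mul0r addr0.
by apply: eq_bigr => i _; rewrite /bump/= add1n subnSK.
Qed.

(** Differentiability up to a finite order is what allows induction: [1 / f] and
    [exp f] have derivatives that involve themselves, so that their smoothness
    is reached one order at a time. *)
Fixpoint diffn (n : nat) f : Prop :=
  if n is n'.+1 then
    exists2 g, (forall s, 0 < s -> is_derive s (1 : R) f (g s)) & diffn n' g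
  else True.

Lemma diffnW n f : diffn n.+1 f -> diffn n f.
Proof.
elim: n f => [//|n IH] f [g fg dg]; exists g => //; exact: IH.
Qed.

Lemma diffn_eq n f g : (forall s, 0 < s -> f s = g s) -> diffn n f -> diffn n g.
Proof.
case: n => [//|n] fg [h fh dh]; exists h => // s s0.
by apply: near_eq_is_derive (fh s s0); exact: near_pos.
Qed.

Lemma diffnD n f g : diffn n f -> diffn n g -> diffn n (fun s => f s + g s).
Proof.
elim: n f g => [//|n IH] f g [f' ff' df'] [g' gg' dg'].
exists (fun s => f' s + g' s) => [s s0|]; last exact: IH.
by apply: is_deriveD; [exact: ff'|exact: gg'].
Qed.

Lemma diffnM n f g : diffn n f -> diffn n g -> diffn n (fun s => f s * g s).
Proof.
elim: n f g => [//|n IH] f g df dg.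
have [f' ff' df'] := df; have [g' gg' dg'] := dg.
exists (fun s => f' s * g s + f s * g' s) => [s s0|].
  by apply: is_derive_mulr; [exact: ff'|exact: gg'].
by apply: diffnD; apply: IH => //; exact: diffnW.
Qed.

Lemma diffn_cst n (c : R) : diffn n (fun=> c).
Proof.
elim: n c => [//|n IH] c; exists (fun=> 0) => // s s0.
exact: is_derive_cst.
Qed.

Lemma diffnV n f : (forall s, 0 < s -> f s != 0) -> diffn n f ->
  diffn n (fun s => (f s)^-1).
Proof.
move=> f0; elim: n => [//|n IH] df; have [f' ff' df'] := df.
exists (fun s => (-1 * f' s) * ((f s)^-1 * (f s)^-1)) => [s s0|].
  apply: is_derive_eq; first by apply: is_deriveV; [exact: f0|exact: ff'].
  rewrite /GRing.scale/= -expr2 exprVn; field; exact: f0.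
apply: diffnM; first by apply: diffnM => //; exact: diffn_cst.
by have := IH (diffnW df) => dV; exact: diffnM.
Qed.

Lemma diffn_jet f : (forall n, diffn n f) -> jet (fun i => derive1n i f).
Proof.
move=> df; have dfi i : forall n, diffn n (derive1n i f).
  elim: i => [//|i IH] n; have [g fg] := IH n.+1.
  apply: diffn_eq => s s0; rewrite derive1nS derive1E.
  by have [_ <-] := fg s s0.
move=> i s s0; have [g fg _] := dfi i 1%N; have [fd _] := fg s s0.
by apply: DeriveDef => //; rewrite derive1nS derive1E.
Qed.

Lemma jet_diffn F n : jet F -> diffn n (F 0%N).
Proof.
elim: n F => [//|n IH] F jF; exists (F 1%N); first exact: jF.
exact: (IH (fun i => F i.+1) (jetS jF)).
Qed.

(** The derivative of [ln F] is a quotient of members of the jet, so that only the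
    smoothness of products and inverses is at stake. *)
Lemma jet_ln F f : jet F -> (forall s, 0 < s -> 0 < F 0%N s) ->
  (forall s, 0 < s -> f s = - ln (F 0%N s)) -> jet (fun i => derive1n i f).
Proof.
move=> jF F0 fE; apply: diffn_jet => n.
apply: (@diffn_eq _ (fun s => - ln (F 0%N s))) => [s s0|]; first by rewrite fE.
case: n => [//|n].
exists (fun s => (-1 * F 1%N s) * (F 0%N s)^-1) => [s s0|]; last first.
  apply: diffnM; first by apply: diffnM; [exact: diffn_cst|exact: (jet_diffn _ (jetS jF))].
  apply: diffnV; first by move=> s s0; rewrite gt_eqF ?F0.
  exact: jet_diffn.
apply: is_derive_eq.
  apply: is_deriveN; apply: is_derive1_comp; last exact: jF.
  by apply: is_derive1_ln; exact: F0.
by rewrite mulN1r mulNr mulrC.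
Qed.

Section Exponential.
Variable f : R -> R.
Hypothesis jf : jet (fun i => derive1n i f).

Let F i := derive1n i f.
Definition exp_jet (t : R) (i : nat) : R -> R :=
  derive1n i (fun s => expR (- (t * f s))).

Let is_derive_exp t s : 0 < s -> is_derive s (1 : R)
  (fun s => expR (- (t * f s))) (- t * (F 1%N s * expR (- (t * f s)))).
Proof.
move=> s0; apply: is_derive_eq.
  apply: is_derive1_comp; apply: is_deriveN; apply: is_derive_cmulr.
  exact: (jf 0%N s0).
by rewrite mulrC !mulNr !mulrA.
Qed.

Lemma jet_exp t : jet (exp_jet t).
Proof.
apply: diffn_jet; elim=> [//|n IH].
exists (fun s => - t * (F 1%N s * expR (- (t * f s)))); last first.
  apply: diffnM; first exact: diffn_cst.
  by apply: diffnM => //; exact: (jet_diffn _ (jetS jf)).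
exact: is_derive_exp.
Qed.

(** Differentiate [- t * f' * exp (- t * f)] by Leibniz' rule; this expresses
    the derivative of order [i.+1] through those of order at most [i]. *)
Lemma exp_jetS t i s : 0 < s ->
  exp_jet t i.+1 s = - t * leibniz (fun i => F i.+1) (exp_jet t) i s.
Proof.
move: i s; apply: jet_eq; first exact: (jetS (jet_exp t)).
  exact: (jetZ _ (jetM (jetS jf) (jet_exp t))).
move=> s s0; rewrite leibniz0; have [_ <-] := jet_exp t 0%N s0.
by have [_ ->] := is_derive_exp t s0.
Qed.

(** Differentiation in [t] commutes with the derivatives in [s]: the jet of
    [- f * exp (- t * f)] satisfies the recurrence obtained by differentiating
    [exp_jetS] in [t], so that both agree by induction on the order. *)
Lemma is_derive_exp_jet t i s : 0 < s ->
  is_derive t (1 : R) (fun t => exp_jet t i s) (- leibniz F (exp_jet t) i s).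
Proof.
move=> s0; pose K := fun i s => -1 * leibniz F (exp_jet t) i s.
have jE := jet_exp t.
have jK : jet K by exact: (jetZ _ (jetM jf jE)).
(* Leibniz' rule applied to [(- f * e)' = - f' * e - t * (f' * (- f * e))],
   where [e = exp (- t * f)]. *)
have KS j : K j.+1 s = -1 * leibniz (fun i => F i.+1) (exp_jet t) j s +
    - t * leibniz (fun i => F i.+1) K j s.
  move: j s s0; apply: jet_eq; first exact: (jetS jK).
    exact: (jetD (jetZ (-1) (jetM (jetS jf) jE)) (jetZ (- t) (jetM (jetS jf) jK))).
  move=> s s0; rewrite !leibniz0 /K leibniz1 exp_jetS// !leibniz0; ring.
rewrite -mulN1r -/(K i s).
elim: i {-2}i (leqnn i) => [|n IH] i.
  rewrite leqn0 => /eqP ->; rewrite /K leibniz0.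
  have D : is_derive t (1 : R) (fun t => expR (- (f s * t)))
      (expR (- (f s * t)) * - (f s * 1)).
    by apply: is_derive1_comp; apply: is_deriveN; apply: is_derive_cmulr.
  rewrite (_ : (fun _ => _) = fun t => expR (- (f s * t))).
    by apply: is_derive_eq D _; rewrite /exp_jet /F !derive1n0 (mulrC t); ring.
  by apply/funext => u; rewrite /exp_jet derive1n0 mulrC.
case: i => [_|i]; first exact: IH.
rewrite ltnS => ile; rewrite KS.
under eq_fun do rewrite (exp_jetS _ _ s0).
apply: is_derive_eq.
  apply: is_derive_mulr; rewrite /leibniz /binconv.
  apply: is_derive_bigsum => j; apply: is_derive_cmulr; apply: IH.
  by rewrite (leq_trans (leq_subr _ _)).
by [].
Qed.

End Exponential.
End Jets.

(** * Sums over [Omega] as linear functionals *)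

Section OmegaSumLinear.
Context {R : realType} {k : nat} (mu : 'I_k -> R).

Lemma omega_sum0 (a : nat -> R) : omega_sum mu 0 a = a 0%N.
Proof. by rewrite omega_sum_coef big_ord1 expr0 coef1 fact0 divr1 mulr1. Qed.

Lemma omega_sum_dirac (n : nat) (a : nat -> R) : (forall z, a z.+1 = 0) ->
  omega_sum mu n a = a 0%N * (n == 0%N)%:R.
Proof.
move=> a0; rewrite omega_sum_coef big_ord_recl big1 => [|z _].
  by rewrite addr0 fact0 divr1 expr0 coef1.
by rewrite /= a0 !mul0r.
Qed.

Lemma continuous_omega_sum (n : nat) (a : nat -> R -> R) :
  (forall z, continuous (a z)) -> continuous (fun u => omega_sum mu n (a ^~ u)).
Proof.
move=> ca; rewrite (_ : (fun _ => _) = fun u =>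
    \sum_(z < n.+1) a z u / z`!%:R * (jump_poly mu ^+ z)`_n); last first.
  by apply/funext => u; rewrite omega_sum_coef.
elim: n.+1 => [|m IH] u.
  rewrite (_ : (fun _ => _) = cst 0); first exact: cvg_cst.
  by apply/funext => v; rewrite big_ord0.
rewrite (_ : (fun _ => _) = fun u =>
    \sum_(z < m) a z u / z`!%:R * (jump_poly mu ^+ z)`_n +
    a m u / m`!%:R * (jump_poly mu ^+ m)`_n); last first.
  by apply/funext => v; rewrite big_ord_recr.
apply: cvgD; first exact: IH.
by apply: cvgM; [apply: cvgM; [exact: ca|exact: cvg_cst]|exact: cvg_cst].
Qed.

Lemma is_derive_omega_sum (n : nat) (a : nat -> R -> R) (da : nat -> R) (t : R) :
  (forall z, is_derive t (1 : R) (a z) (da z)) ->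
  is_derive t (1 : R) (fun u => omega_sum mu n (a ^~ u)) (omega_sum mu n da).
Proof.
move=> Da; under eq_fun do rewrite omega_sum_coef.
rewrite omega_sum_coef.
under eq_fun do under eq_bigr do rewrite -mulrA mulrC.
under eq_bigr do rewrite -mulrA mulrC.
by apply: is_derive_bigsum => z; apply: is_derive_cmulr.
Qed.

Lemma Rintegral_omega_sum {d : measure_display} {T : measurableType d}
    (P : probability T R) (n : nat) (a : nat -> T -> R) :
  (forall z, P.-integrable setT (EFin \o a z)) ->
  \int[P]_w omega_sum mu n (a ^~ w) =
  omega_sum mu n (fun z => \int[P]_w a z w).
Proof.
move=> ia; rewrite omega_sum_coef.
pose c (z : 'I_n.+1) := (jump_poly mu ^+ z)`_n / z`!%:R.
rewrite (@eq_Rintegral _ _ _ _ _ (fun w => \sum_(z < n.+1) c z * a z w)); last first.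
  move=> w _; rewrite omega_sum_coef; apply: eq_bigr => z _.
  by rewrite mulrAC mulrC /c; ring.
have ica (z : 'I_n.+1) : P.-integrable setT (fun w => (c z * a z w)%:E).
  have := integrableZl measurableT (c z) (ia z).
  by apply: eq_integrable.
rewrite /Rintegral; under eq_integral do rewrite -sumEFin.
rewrite integral_sum// -sum_fine; last by move=> z _; exact: integrable_fin_num.
apply: eq_bigr => z _.
rewrite -[fine _]/(\int[P]_w (c z * a z w)) RintegralZl// /c.
by rewrite /Rintegral; ring.
Qed.

End OmegaSumLinear.

(** * The Laplace transform of a nonnegative random variable *)

Section Tilt.
Context {R : realType}.

(** Keep a single term of the exponential series of [a * x]. *)
Lemma pow_expN_le (n : nat) (a x : R) : 0 < a -> 0 <= x ->
  x ^+ n * expR (- (a * x)) <= n`!%:R / a ^+ n.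
Proof.
move=> a0 x0; rewrite expRN ler_pdivrMr ?expR_gt0// mulrAC.
rewrite ler_pdivlMr ?exprn_gt0// -exprMn (mulrC a x).
rewrite -ler_pdivrMl ?ltr0n ?fact_gt0// [leLHS]mulrC.
case: n => [|n].
  by rewrite expr0 fact0 invr1 mulr1 -expR0 ler_expR mulr_ge0// ltW.
have ax0 : 0 <= x * a by rewrite mulr_ge0// ltW.
by apply: le_trans (expR_ge1Dxn n ax0); rewrite lerDr.
Qed.

(** The [i]-th derivative in [s] of [exp (- s * x)]. *)
Definition tilt (i : nat) (s x : R) : R := (- x) ^+ i * expR (- (s * x)).

Lemma is_derive_tilt i s x :
  is_derive s (1 : R) (fun s => tilt i s x) (tilt i.+1 s x).
Proof.
have D : is_derive s (1 : R) (fun s => expR (- (x * s)))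
    (expR (- (x * s)) * - (x * 1)).
  by apply: is_derive1_comp; apply: is_deriveN; apply: is_derive_cmulr.
rewrite (_ : (fun _ => _) = fun s => (- x) ^+ i * expR (- (x * s))).
  apply: is_derive_eq (is_derive_cmulr ((- x) ^+ i) D) _.
  by rewrite /tilt exprS (mulrC s); ring.
by apply/funext => u; rewrite /tilt (mulrC u).
Qed.

Lemma continuous_tilt i s : continuous (tilt i s).
Proof.
move=> x; apply: cvgM.
  apply: (@cvg_comp _ _ _ -%R (fun y : R => y ^+ i) _ (nbhs (- x))).
    exact: opp_continuous.
  exact: exprn_continuous.
apply: (@cvg_comp _ _ _ (fun y : R => - (s * y)) expR _ (nbhs (- (s * x)))).
  by apply: cvgN; apply: cvgM; [exact: cvg_cst|exact: cvg_id].
exact: continuous_expR.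
Qed.

(** A bound uniform in [x] and in [s >= a], which dominates the difference
    quotients of the Laplace transform. *)
Lemma tilt_le i s a x : 0 < a -> a <= s -> 0 <= x ->
  `|tilt i s x| <= i`!%:R / a ^+ i.
Proof.
move=> a0 as_ x0; rewrite /tilt normrM normrX normrN !ger0_norm ?expR_ge0//.
apply: le_trans (pow_expN_le i a0 x0).
by rewrite ler_wpM2l ?exprn_ge0// ler_expR lerN2 ler_wpM2r.
Qed.

End Tilt.

Section LaplaceMoments.
Context {d : measure_display} {T : measurableType d} {R : realType}.
Variables (P : probability T R) (X : T -> R).
Hypothesis mX : measurable_fun setT X.
Hypothesis X_ge0 : forall w, 0 <= X w.

Lemma measurable_tilt i s : measurable_fun setT (tilt i s \o X).
Proof.
apply: measurableT_comp => //; apply: continuous_measurable_fun.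
exact: continuous_tilt.
Qed.

Lemma integrable_tilt i s : 0 < s -> P.-integrable setT (EFin \o (tilt i s \o X)).
Proof.
move=> s0; apply: measurable_bounded_integrable => //.
- by rewrite -ge0_fin_numE// fin_num_measure.
- exact: measurable_tilt.
- exists (i`!%:R / s ^+ i); split; first exact: num_real.
  by move=> M iM w _ /=; apply: le_trans (ltW iM); exact: tilt_le.
Qed.

Definition laplace_moment (i : nat) (s : R) : R :=
  \int[P]_w tilt i s (X w).

(** Differentiation under the expectation: away from [s = 0] the derivatives of
    the integrand are bounded by a constant, which is integrable for a
    probability. *)
Lemma jet_laplace_moment : jet laplace_moment.
Proof.
move=> i s s0.
pose f u w := tilt i u (X w).
(* Any interval around [s] whose left end is positive would do. *)
have Is : `](s / 2), (s + 1)[%classic s.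
  by rewrite /= in_itv/= ltrDl ltr01 andbT ltr_pdivrMr// ltr_pMr// ltr1n.
have s20 : 0 < s / 2 by rewrite divr_gt0.
have intf x : `](s / 2), (s + 1)[%classic x ->
    P.-integrable setT (EFin \o f x).
  rewrite /= in_itv/= => /andP[sx _]; apply: integrable_tilt.
  exact: lt_trans sx.
have derf x w : `](s / 2), (s + 1)[%classic x -> [set: T] w ->
    derivable (f ^~ w) x 1.
  by move=> _ _; have [] := is_derive_tilt i x (X w).
pose G (w : T) := i.+1`!%:R / (s / 2) ^+ i.+1.
have G0 w : 0 <= G w by rewrite divr_ge0// exprn_ge0// ltW.
have intG : P.-integrable setT (EFin \o G).
  exact: finite_measure_integrable_cst.
have dfE x w : partial1of2 f x w = tilt i.+1 x (X w).
  by rewrite partial1of2E; have [_ ->] := is_derive_tilt i x (X w).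
have Gub x w : `](s / 2), (s + 1)[%classic x -> [set: T] w ->
    `|partial1of2 f x w| <= G w.
  rewrite /= in_itv/= => /andP[sx _] _; rewrite dfE; apply: tilt_le => //.
  exact: ltW.
apply: DeriveDef.
  exact: (derivable_under_integral measurableT Is intf derf G0 intG Gub).
have := differentiation_under_integral measurableT Is intf derf G0 intG Gub.
rewrite derive1E => ->; apply: eq_Rintegral => w _; exact: dfE.
Qed.

End LaplaceMoments.

(** * Evaluation at an independent random time *)

Section UniformClock.
Context {R : realType}.

(** The first multiple of [1 / (N + 1)] strictly after [x]. Strictness matters:
    right-continuity only controls times larger than [x]. *)
Definition next_tick (N : nat) (x : R) : R :=
  (Num.truncn (N.+1%:R * x)).+1%:R / N.+1%:R.

Definition tick_cell (N i : nat) : set R :=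
  `[(i%:R / N.+1%:R)%R, (i.+1%:R / N.+1%:R)%R[%classic.

Lemma next_tick_cell N i x : tick_cell N i x -> next_tick N x = i.+1%:R / N.+1%:R.
Proof.
rewrite /tick_cell/= in_itv/= => /andP[lo hi]; rewrite /next_tick.
rewrite (_ : Num.truncn _ = i)//; apply: truncn_def.
by rewrite mulrC -ler_pdivrMr// lo/= -ltr_pdivlMr.
Qed.

Lemma tick_cellP N x : 0 <= x -> tick_cell N (Num.truncn (N.+1%:R * x)) x.
Proof.
move=> x0; rewrite /tick_cell/= in_itv/= ler_pdivrMr// ltr_pdivlMr// mulrC.
by apply: truncn_itv; rewrite mulr_ge0.
Qed.

Lemma trivIset_tick_cell N : trivIset setT (tick_cell N).
Proof.
apply/trivIsetP => i j _ _ ij; apply/seteqP; split => // x [].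
move=> /next_tick_cell xi /next_tick_cell; rewrite xi => /divIf.
move=> /(_ _)/eqP; rewrite eqr_nat pnatr_eq0 eqSS => /(_ isT)/eqP.
by move=> eij; rewrite eij eqxx in ij.
Qed.

Lemma next_tick_gt N x : x < next_tick N x.
Proof. by rewrite /next_tick ltr_pdivlMr// mulrC truncnS_gt. Qed.

Lemma next_tick_le N x : 0 <= x -> next_tick N x <= x + N.+1%:R^-1.
Proof.
move=> x0; rewrite /next_tick ler_pdivrMr// mulrDl mulVf ?pnatr_eq0//.
by rewrite -natr1 lerD2r mulrC truncn_le mulr_ge0.
Qed.

Lemma cvg_next_tick x : 0 <= x -> next_tick N x @[N --> \oo] --> x.
Proof.
move=> x0; apply: (@squeeze_cvgr _ _ _ _ (cst x) (fun N => x + N.+1%:R^-1)).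
- by apply: nearW => N; rewrite /= ltW ?next_tick_gt//= next_tick_le.
- exact: cvg_cst.
- by rewrite -[X in _ --> X]addr0; apply: cvgD; [exact: cvg_cst|exact: cvg_harmonic].
Qed.

End UniformClock.

Section RandomTime.
Context {d : measure_display} {T : measurableType d} {R : realType}.
Variables (P : probability T R) (M : R -> T -> nat) (tau : T -> R).
Variables (n : nat) (q : R -> R).
Hypothesis mM : forall u, 0 <= u -> measurable [set w | M u w = n].
Hypothesis mtau : measurable_fun setT tau.
Hypothesis tau_ge0 : forall w, 0 <= tau w.
Hypothesis indep : forall u (B : set R), 0 <= u -> measurable B ->
  P ([set w | M u w = n] `&` tau @^-1` B) =
  (P [set w | M u w = n] * P (tau @^-1` B))%E.
Hypothesis M_right_continuous : forall w u, 0 <= u ->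
  (M v w)%:R @[v --> u^'+] --> ((M u w)%:R : R).
Hypothesis Mq : forall u, 0 <= u -> P [set w | M u w = n] = (q u)%:E.
Hypothesis q_continuous : continuous q.

Let q_ge0 u : 0 <= u -> 0 <= q u.
Proof. by move=> u0; rewrite -lee_fin -Mq. Qed.

Let q_le1 u : 0 <= u -> q u <= 1.
Proof. by move=> u0; rewrite -lee_fin -Mq ?probability_le1//; exact: mM. Qed.

Let tick N w := next_tick N (tau w).
Let tick_ge0 N w : 0 <= tick N w.
Proof. by rewrite (le_trans (tau_ge0 w))// ltW// next_tick_gt. Qed.

Let cell N i : set T := tau @^-1` tick_cell N i.

Let mcell N i : measurable (cell N i).
Proof.
by rewrite -[cell N i]setTI; apply: mtau => //; exact: measurable_itv.
Qed.

Let bigcup_cell N : \bigcup_i cell N i = setT.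
Proof.
apply/seteqP; split => // w _.
by exists (Num.truncn (N.+1%:R * tau w)) => //; exact: tick_cellP.
Qed.

Let trivIset_cell N : trivIset setT (cell N).
Proof.
apply/trivIsetP => i j _ _ ij; rewrite /cell -preimage_setI.
by have /trivIsetP -> := @trivIset_tick_cell R N; rewrite ?preimage_set0.
Qed.

Let hit N := [set w | M (tick N w) w = n].

Let hit_cell N i :
  hit N `&` cell N i = [set w | M (i.+1%:R / N.+1%:R) w = n] `&` cell N i.
Proof.
by apply/seteqP; split => w [] /= + wi; rewrite /hit/= /tick (next_tick_cell wi).
Qed.

Let mhit N : measurable (hit N).
Proof.
rewrite -[hit N]setIT -(bigcup_cell N) setI_bigcupr; apply: bigcup_measurable.
by move=> i _; rewrite hit_cell; apply: measurableI => //; apply: mM; rewrite divr_ge0.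
Qed.

Let mqtick N : measurable_fun setT (q \o tick N).
Proof.
rewrite -(bigcup_cell N); apply/measurable_fun_bigcup => // i.
apply: (@eq_measurable_fun _ _ _ _ _ (cst (q (i.+1%:R / N.+1%:R)))) => //.
by move=> w; rewrite inE => wi; rewrite /= /tick (next_tick_cell wi).
Qed.

(** On each cell the clock is constant, and independence factors the event. *)
Let int_hit N : (\int[P]_w (\1_(hit N) w)%:E = \int[P]_w (q (tick N w))%:E)%E.
Proof.
rewrite -(bigcup_cell N) !ge0_integral_bigcup ?bigcup_cell//.
- apply: eq_eseriesr => i _.
  have t0 : 0 <= i.+1%:R / N.+1%:R :> R by rewrite divr_ge0.
  transitivity ((q (i.+1%:R / N.+1%:R))%:E * P (cell N i))%E.
    rewrite integral_indic// hit_cell -Mq//; apply: indep => //.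
    exact: measurable_itv.
  rewrite [RHS](eq_integral (cst (q (i.+1%:R / N.+1%:R))%:E)); last first.
    by move=> w; rewrite inE => wi; rewrite /= /tick (next_tick_cell wi).
  by rewrite integral_cst.
- exact/measurable_EFinP/mqtick.
- by move=> w _; rewrite lee_fin q_ge0.
- exact/measurable_EFinP/measurable_indic.
Qed.

(** The count is integer-valued, so that right-continuity makes it eventually
    equal to its limit along the ticks that decrease to [tau w]. *)
Let cvg_hit w :
  (\1_(hit N) w : R) @[N --> \oo] --> (\1_[set w | M (tau w) w = n] w : R).
Proof.
have Mtick : ((M (tick N w) w)%:R : R) @[N --> \oo] --> ((M (tau w) w)%:R : R).
  have /cvg_at_rightP := @M_right_continuous w _ (tau_ge0 w); apply; split.
    by move=> N; exact: next_tick_gt.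
  exact: cvg_next_tick.
have hitE : \forall N \near \oo,
    \1_(hit N) w = \1_[set w | M (tau w) w = n] w :> R.
  move/cvgrPdist_lt: Mtick => /(_ _ ltr01); apply: filterS => N.
  move=> MN; suff eqM : M (tick N w) w = M (tau w) w.
    rewrite !indicE; congr ((nat_of_bool _)%:R).
    by apply/idP/idP; rewrite !inE /= /hit/= eqM.
  (* In the integers, a distance less than 1 is 0. *)
  apply/eqP; move: MN; rewrite -[_%:R]/((M (tau w) w)%:~R).
  rewrite -[X in _ - X]/((M (tick N w) w)%:~R).
  rewrite -rmorphB/= -intr_norm -[1]/(1%:~R) ltr_int.
  lia.
apply: cvg_near_cst; exact: hitE.
Qed.

Let dominated_integral (f_ : (T -> R)^nat) (f : T -> R) :
  (forall N, measurable_fun setT (f_ N)) -> measurable_fun setT f ->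
  (forall w, f_ N w @[N --> \oo] --> f w) -> (forall N w, `|f_ N w| <= 1) ->
  (\int[P]_w (f_ N w)%:E)%E @[N --> \oo] --> (\int[P]_w (f w)%:E)%E.
Proof.
move=> mf_ mf f_f f_1.
have int1 : P.-integrable setT (EFin \o cst (1 : R)).
  exact: finite_measure_integrable_cst.
have [//||||_ _] := @dominated_convergence _ _ _ P setT measurableT
  (fun N w => (f_ N w)%:E) (fun w => (f w)%:E) _ _ _ _ int1 => //.
- by move=> N; exact/measurable_EFinP.
- exact/measurable_EFinP.
- by apply: aeW => w _; apply: cvg_EFin; [exact: nearW|exact: f_f].
- by apply: aeW => w N _; rewrite lee_fin.
Qed.

(** An independent random time can be substituted into the law of [M]: both sides
    are limits, by dominated convergence, of their analogues for the clock
    rounded up to the next tick, for which the equality is a countable sum of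
    products. *)
Lemma prob_random_time :
  P [set w | M (tau w) w = n] = (\int[P]_w (q (tau w))%:E)%E.
Proof.
have mA : measurable [set w | M (tau w) w = n].
  apply/(@measurable_indicP _ _ R); apply: measurable_fun_cvg => [N|w _].
    exact: measurable_indic (mhit N).
  exact: cvg_hit.
have lhs : (\int[P]_w (\1_(hit N) w)%:E)%E @[N --> \oo] -->
    P [set w | M (tau w) w = n].
  rewrite (_ : P _ = \int[P]_w (\1_[set w | M (tau w) w = n] w)%:E)%E; last first.
    by rewrite integral_indic// setIT.
  apply: dominated_integral => // [|N w].
  - by move=> N; exact: measurable_indic.
  - by rewrite ger0_norm// indicE lern1 leq_b1.
have rhs : (\int[P]_w (q (tick N w))%:E)%E @[N --> \oo] -->
    (\int[P]_w (q (tau w))%:E)%E.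
  apply: (dominated_integral (f_ := fun N w => q (tick N w))) => // [|w|N w].
  - apply: measurableT_comp => //; exact: continuous_measurable_fun.
  - apply: (@cvg_comp _ _ _ (fun N => tick N w) q _ (nbhs (tau w))).
      exact: cvg_next_tick.
    exact: q_continuous.
  - by rewrite ger0_norm ?q_ge0// q_le1.
rewrite -(cvg_lim _ lhs)// -(cvg_lim _ rhs)//.
by congr (lim (_ @ \oo)); apply/funext => N; exact: int_hit.
Qed.

End RandomTime.

(** * The time-changed counting process *)

Section TimeChange.
Context {d : measure_display} {T : measurableType d} {R : realType}.
Variables (P : probability T R) (k : nat) (lam : 'I_k -> R).
Variables (M : R -> T -> nat) (f : R -> R) (D : R -> T -> R).
Hypothesis Lam_gt0 : 0 < total_rate lam.
Hypothesis M_gcp : generalized_counting_process P lam M.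
Hypothesis D_sub : levy_subordinator P f D.
Hypothesis MD_indep : independent_processes P M D.

Let Lam := total_rate lam.

Let mD t : 0 <= t -> measurable_fun setT (D t).
Proof. exact: (levy_measurable (subordinator_levy D_sub)). Qed.

(** The factor [u ^+ z] of the law is written [(- u) ^+ z] and the sign is moved
    to the rates, as in the system of equations. *)
Lemma gcp_prob n u : 0 <= u -> P [set w | M u w = n] =
  (omega_sum (fun j => - lam j) n (fun z => tilt z Lam u))%:E.
Proof.
move=> u0; rewrite (gcp_distribution M_gcp)//; congr _%:E.
apply: eq_fsbigr => x _; rewrite /tilt mulrAC; congr (_ * _).
rewrite -prodrXr -big_split/=; apply: eq_bigr => j _.
by rewrite mulrA -exprMn mulrNN [u * _]mulrC.
Qed.

Lemma measurable_count n u : 0 <= u -> measurable [set w | M u w = n].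
Proof.
move=> u0; rewrite (_ : [set _ | _] =
    setT `&` (fun w => (M u w)%:R : R) @^-1` [set n%:R]).
  exact: (levy_measurable (gcp_levy M_gcp)).
rewrite setTI; apply/seteqP; split => w /= => [->//|/eqP].
by rewrite eqr_nat => /eqP.
Qed.

Lemma count_time_indep n u t (B : set R) : 0 <= u -> 0 <= t -> measurable B ->
  P ([set w | M u w = n] `&` D t @^-1` B) =
  (P [set w | M u w = n] * P (D t @^-1` B))%E.
Proof.
move=> u0 t0 mB; apply: MD_indep; apply: sub_sigma_algebra.
  by exists u, [set n].
by exists t, B.
Qed.

Lemma laplace_moment0 t s : 0 <= t -> 0 <= s ->
  laplace_moment P (D t) 0 s = expR (- (t * f s)).
Proof.
move=> t0 s0; rewrite -[RHS]/(fine (expR (- (t * f s)))%:E).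
rewrite -(subordinator_laplace D_sub)// unlock; congr fine.
by apply: eq_integral => w _; rewrite /tilt expr0 mul1r.
Qed.

(** The Laplace transform of [D 1] is smooth and positive, and [f] is minus its
    logarithm; this gives all derivatives of [f] without using its integral
    representation. *)
Lemma jet_bernstein : jet (fun i => derive1n i f).
Proof.
have D1_ge0 w : 0 <= D 1 w by exact: (subordinator_ge0 D_sub).
apply: (@jet_ln _ (laplace_moment P (D 1)) f) => [|s s0|s s0].
- exact: (jet_laplace_moment P (mD ler01) D1_ge0).
- by rewrite laplace_moment0 ?ltW// expR_gt0.
- by rewrite laplace_moment0 ?ltW// mul1r expRK opprK.
Qed.

Lemma laplace_momentE t i s : 0 <= t -> 0 < s ->
  laplace_moment P (D t) i s = exp_jet f t i s.
Proof.
move=> t0; move: i s; apply: jet_eq.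
- by apply: jet_laplace_moment; [exact: mD|move=> w; exact: (subordinator_ge0 D_sub)].
- exact: (jet_exp jet_bernstein).
- by move=> s s0; rewrite laplace_moment0 ?(ltW s0)//.
Qed.

(** The right-hand side is defined for all real [t], which extends the state
    probabilities smoothly across [t = 0]. *)
Lemma state_prob_time_change n t : 0 <= t ->
  state_prob P (time_change M D) n t =
  omega_sum (fun j => - lam j) n (fun z => exp_jet f t z Lam).
Proof.
move=> t0; have Dt0 w : 0 <= D t w by exact: (subordinator_ge0 D_sub).
rewrite /state_prob /time_change.
rewrite (@prob_random_time _ _ _ P M (D t) n
  (fun u => omega_sum (fun j => - lam j) n (fun z => tilt z Lam u))); first last.
- by apply: continuous_omega_sum => z; exact: continuous_tilt.
- by move=> u; exact: gcp_prob.
- by move=> w u; exact: (levy_right_continuous (gcp_levy M_gcp)).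
- by move=> u B u0 mB; exact: count_time_indep.
- exact: Dt0.
- exact: mD.
- by move=> u; exact: measurable_count.
rewrite -[LHS]/(\int[P]_w omega_sum (fun j => - lam j) n (fun z => tilt z Lam (D t w))).
rewrite Rintegral_omega_sum; last first.
  by move=> z; exact: (integrable_tilt P (mD t0) Dt0 z Lam_gt0).
congr omega_sum; apply/funext => z.
exact: laplace_momentE.
Qed.

End TimeChange.

Theorem proposition5p1 (d : measure_display) (T : measurableType d)
    (R : realType) (P : probability T R) (k : nat) (lam : 'I_k -> R)
    (M : R -> T -> nat) (f : R -> R) (D : R -> T -> R)
    (k_gt0 : (0 < k)%N) (lam_gt0 : forall j, 0 < lam j)
    (M_gcp : generalized_counting_process P lam M)
    (D_sub : levy_subordinator P f D)
    (MD_indep : independent_processes P M D) :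
  let Lam := total_rate lam in
  let p := state_prob P (time_change M D) in
  let rhs := fun (n : nat) (t : R) =>
    - f Lam * p n t
    - \sum_(1 <= m < n.+1) \sum_(x \in Omega k m)
        (derive1n (\sum_(j < k) x j)%N f) Lam *
        (\prod_(j < k) ((- lam j) ^+ x j / (x j)`!%:R)) *
        p (n - m)%N t in
  [/\ forall (n : nat) (t : R), 0 < t ->
        is_derive t (1 : R) (p n : R -> R) (rhs n t),
      forall n : nat,
        (h^-1 * (p n h - p n 0)) @[h --> 0^'+] --> rhs n 0,
      p 0%N 0 = 1 &
      forall n : nat, (1 <= n)%N -> p n 0 = 0].
Proof.
move=> Lam p rhs.
have Lam0 : 0 < Lam.
  rewrite /Lam /total_rate (bigD1 (Ordinal k_gt0))//=.
  by rewrite ltr_pwDl ?sumr_ge0// => j _; rewrite ltW.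
have jf := jet_bernstein D_sub.
pose mu j := - lam j.
pose g n t := omega_sum mu n (fun z => exp_jet f t z Lam).
have pE n t : 0 <= t -> p n t = g n t.
  by move=> t0; exact: state_prob_time_change.
have rhsE n t : 0 <= t -> rhs n t =
    - \sum_(m < n.+1) omega_sum mu m (fun z => derive1n z f Lam) * g (n - m)%N t.
  move=> t0; rewrite /rhs big_ord_recl omega_sum0 subn0 -pE// opprD mulNr.
  congr (_ - _); rewrite big_add1 /= big_mkord; apply: eq_bigr => m _.
  by rewrite -mulr_fsuml pE.
have dg n t : is_derive t (1 : R) (g n)
    (- \sum_(m < n.+1) omega_sum mu m (fun z => derive1n z f Lam) * g (n - m)%N t).
  rewrite -omega_sumM -mulN1r.
  pose da z := - leibniz (fun i => derive1n i f) (exp_jet f t) z Lam.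
  rewrite (_ : -1 * _ = omega_sum mu n da).
    by apply: is_derive_omega_sum => z; exact: is_derive_exp_jet.
  rewrite !omega_sum_coef mulr_sumr; apply: eq_bigr => z _.
  by rewrite /da /leibniz mulN1r !mulNr.
(* At [t = 0] the function [exp (- t * f)] is the constant 1. *)
have g0 n : g n 0 = (n == 0%N)%:R.
  rewrite /g omega_sum_dirac => [|z]; last by rewrite exp_jetS// oppr0 mul0r.
  by rewrite /exp_jet derive1n0 mul0r oppr0 expR0 mul1r.
split.
- move=> n t t0; rewrite rhsE ?ltW//; apply: near_eq_is_derive (dg n t).
  by apply: near_pos t0 _ => u u0; rewrite pE ?ltW.
- move=> n; rewrite rhsE//; have [dg0 <-] := dg n 0.
  have /cvg_dnbhs_at_right : h^-1 *: (g n (h *: 1 + 0) - g n 0) @[h --> 0^'] --> 'D_1 (g n) 0 := dg0.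
  apply: cvg_trans; apply: near_eq_cvg; near=> h.
  have h0 : 0 < h by near: h; exact: nbhs_right_gt.
  rewrite (pE n h (ltW h0)) (pE n 0 (lexx 0)).
  by congr (_ *: (g n _ - _)); rewrite addr0 -[RHS]mulr1.
- by rewrite pE// g0.
- by move=> [//|n] _; rewrite pE// g0.
Unshelve. all: by end_near.
Qed.
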